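(* Let $(m_n)_{n\in\mathbb{N}}$ be a sequence in $(0,\infty)$. For each $n\in\mathbb{N}$, let $(X_k^{(n)})_{k\in\mathbb{Z}_+}$ be a Galton--Watson process with inhomogeneous immigration, with offspring variables $\{\xi_{k,j}^{(n)}:k,j\in\mathbb{N}\}$ and immigration process $(Y_k^{(n)})_{k\in\mathbb{Z}_+}$, as defined in the context. Assume that $\mathbb{E}(\xi_{1,1}^{(n)})<\infty$ for all $n\in\mathbb{N}$, that $\mathbb{E}(Y_k^{(n)})<\infty$ for all $k\in\mathbb{Z}_+$, $n\in\mathbb{N}$, and that there exists $\beta\in D(\mathbb{R}_+,\mathbb{R})$ such that $$\left(\mathbb{E}\big(m_n^{-1}Y^{(n)}_{\lfloor nt\rfloor}\big)\right)_{t\in\mathbb{R}_+}\stackrel{J_1}{\longrightarrow}(\beta(t))_{t\in\mathbb{R}_+}\qquad\text{as } n\to\infty.$$ (i) If there exists $a\in[0,1)$ such that $\mathbb{E}(\xi_{1,1}^{(n)})\to a$ as $n\to\infty$, and $\beta$ is continuous with $\beta(0)=0$, then $m_n^{-1}\mathbb{E}\big(X^{(n)}_{\lfloor nt\rfloor}\big)$ converges to $\frac{1}{1-a}\beta(t)$ locally uniformly in $t\in\mathbb{R}_+$ as $n\to\infty$. (ii) If there exist $\gamma\in\mathbb{R}$ and $\gamma_n\in\mathbb{R}$, $n\in\mathbb{N}$, such that $\gamma_n\to\gamma$ as $n\to\infty$ and $\mathbb{E}(\xi_{1,1}^{(n)})=1+\frac{\gamma_n}{n}$ for all $n\in\mathbb{N}$,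 then $(nm_n)^{-1}\mathbb{E}\big(X^{(n)}_{\lfloor nt\rfloor}\big)$ converges to $\int_0^t e^{\gamma(t-s)}\beta(s)\,\mathrm{d}s$ locally uniformly in $t\in\mathbb{R}_+$ as $n\to\infty$.
   Context: $\mathbb{Z}_+$, $\mathbb{N}$, $\mathbb{R}_+$ denote the non-negative integers, the positive integers and the non-negative reals. A Galton--Watson process with inhomogeneous immigration: for each $n\in\mathbb{N}$, $(Y_k^{(n)})_{k\in\mathbb{Z}_+}$ is an arbitrary $\mathbb{Z}_+$-valued stochastic process (its members may be dependent and have different distributions), $\{\xi^{(n)}_{k,j}:k,j\in\mathbb{N}\}$ are independent, identically distributed $\mathbb{Z}_+$-valued random variables independent of $\{Y^{(n)}_k:k\in\mathbb{Z}_+\}$, and $X_0^{(n)}=0$, $X_k^{(n)}=\sum_{j=1}^{X^{(n)}_{k-1}}\xi^{(n)}_{k,j}+Y^{(n)}_{k-1}$ for $k\in\mathbb{N}$, with $\sum_{j=1}^0:=0$. $D(\mathbb{R}_+,\mathbb{R}^d)$ is the space of càdlàg functions (right continuous with left limits) $\mathbb{R}_+\to\mathbb{R}^d$. $f_n\stackrel{J_1}{\longrightarrow}f$ denotes convergence in the Skorokhod $J_1$ topology: there are continuous strictly increasing $\lambda_n:\mathbb{R}_+\to\mathbb{R}_+$ with $\lambda_n(0)=0$, $\lim_{t\to\infty}\lambda_n(t)=\infty$, $\sup_{t\in\mathbb{R}_+}|\lambda_n(t)-t|\to0$ and $\sup_{t\in[0,K]}\|f_n(\lambda_n(t))-f(t)\|\to0$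 for all $K>0$. Locally uniform convergence $f_n\to f$ means $\sup_{t\in[0,T]}\|f_n(t)-f(t)\|\to0$ for all $T\in\mathbb{R}_+$. *)

(* Defs.v *)
From mathcomp Require Import all_boot all_order all_algebra.
From mathcomp Require Import all_classical all_reals all_analysis.

Set Implicit Arguments.
Unset Strict Implicit.
Unset Printing Implicit Defensive.

Import Order.TTheory GRing.Theory Num.Theory.
Import numFieldTopology.Exports numFieldNormedType.Exports.

Local Open Scope classical_set_scope.
Local Open Scope ring_scope.

(* Functions on the half-line [0, +oo[ are represented by functions on R whose
   values at negative arguments are never used. Functions built from
   expectations take values in \bar R, where expectations live; a supremum
   distance to a real-valued function is then +oo as soon as one of the values
   involved is infinite. *)

Section Skorokhod.
Context {R : realType}.

Definition sup_dist (A : set R) (f : R -> \bar R) (g : R -> R) : \bar R :=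
  ereal_sup [set `|f t - (g t)%:E|%E | t in A].

Definition cadlag (f : R -> R) : Prop :=
  (forall t, 0 <= t -> f x @[x --> t^'+] --> f t) /\
  (forall t, 0 < t -> cvg (f x @[x --> t^'-])).

(* Positivity of [lam] on [0, +oo[ follows from monotonicity and [lam 0 = 0]. *)
Definition time_change (lam : R -> R) : Prop :=
  [/\ {within `[0, +oo[, continuous lam},
      {in `[0, +oo[ &, {homo lam : x y / x < y}},
      lam 0 = 0 &
      lam t @[t --> +oo] --> +oo].

Definition cvg_J1 (f_ : nat -> R -> \bar R) (f : R -> R) : Prop :=
  exists lam : nat -> R -> R,
    [/\ forall n, time_change (lam n),
        sup_dist `[0, +oo[ (fun t => (lam n t)%:E) id @[n --> \oo] --> 0%E &
        forall K, 0 < K ->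
          sup_dist `[0, K] (fun t => f_ n (lam n t)) f @[n --> \oo] --> 0%E].

Definition cvg_locally_uniformly (f_ : nat -> R -> \bar R) (f : R -> R) : Prop :=
  forall T, 0 <= T -> sup_dist `[0, T] (f_ n) f @[n --> \oo] --> 0%E.

End Skorokhod.

Section Independence.
Context {d d' : measure_display} {T : measurableType d} {T' : measurableType d'}.
Context {R : realType} (P : probability T R).

Definition mutually_independent (I : choiceType) (D : set I)
    (X : I -> {RV P >-> T'}) : Prop :=
  forall (s : seq I) (A : I -> set T'),
    uniq s -> [set` s] `<=` D -> (forall i, measurable (A i)) ->
    P (\bigcap_(i in [set` s]) (X i @^-1` A i)) =
    (\prod_(i <- s) P (X i @^-1` A i))%E.

Definition generated_sigma_algebra (I : Type) (D : set I)
    (X : I -> {RV P >-> T'}) : set (set T) :=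
  <<s \bigcup_(i in D) preimage_set_system setT (X i) measurable >>.

Definition independent_families (I J : Type) (D : set I) (E : set J)
    (X : I -> {RV P >-> T'}) (Y : J -> {RV P >-> T'}) : Prop :=
  forall A B, generated_sigma_algebra D X A -> generated_sigma_algebra E Y B ->
    P (A `&` B) = (P A * P B)%E.

End Independence.

Section GaltonWatson.
Context {d : measure_display} {T : measurableType d} {R : realType}.
Context (P : probability T R).

(* The offspring variables are indexed by pairs of positive integers; the
   variables [xi 0 j] and [xi k 0] play no role. *)
Definition GW_offspring (xi : nat -> nat -> {RV P >-> nat}) : Prop :=
  mutually_independent [set kj : nat * nat | (0 < kj.1)%N /\ (0 < kj.2)%N]
    (fun kj => xi kj.1 kj.2) /\
  (forall k j, (0 < k)%N -> (0 < j)%N ->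
    forall A, measurable A ->
      distribution P (xi k j) A = distribution P (xi 1%N 1%N) A).

Definition GW_immigration (xi : nat -> nat -> {RV P >-> nat})
    (Y : nat -> {RV P >-> nat}) (X : nat -> T -> nat) : Prop :=
  [/\ GW_offspring xi,
      independent_families
        [set kj : nat * nat | (0 < kj.1)%N /\ (0 < kj.2)%N] [set: nat]
        (fun kj => xi kj.1 kj.2) Y,
      forall w, X 0%N w = 0%N &
      forall k w, X k.+1 w =
        (\sum_(1 <= j < (X k w).+1) xi k.+1 j w + Y k w)%N].

End GaltonWatson.

(* Main.v *)
(* Conditioning on the past gives E X_(k+1) = E xi * E X_k + E Y_k, since xi_(k+1,j)
   is independent of X_k; what remains is a deterministic linear recursion.

   (i) A J1 limit that is continuous is a locally uniform limit, so the error
   E X_k / m_n - beta (k/n) / (1-a) solves a contracting linear recursion with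
   a uniformly small source term.

   (ii) With alpha_n = 1 + gamma_n / n, the solution of the recursion is
   E X_k / (n m_n) = alpha_n^k * int_0^(k/n) alpha_n^-(floor(ns)+1) f_n(s) ds,
   f_n(s) = E Y_floor(ns) / m_n, and alpha_n^floor(nt) -> e^(gamma t) locally
   uniformly. J1 convergence makes f_n locally bounded and convergent at every
   continuity point of beta, that is, off a countable set; dominated convergence
   then gives the limit, uniformly in t. *)

Require Import Defs.
From mathcomp Require Import all_boot all_order all_algebra.
From mathcomp Require Import all_classical all_reals all_analysis.
From mathcomp Require Import ring lra.
From mathcomp Require Import measurable_realfun.
Import Order.TTheory GRing.Theory Num.Theory.
Import numFieldTopology.Exports numFieldNormedType.Exports.
Local Open Scope classical_set_scope.
Local Open Scope ring_scope.

(** * Independence and means *)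

(** Partition by the value of [N]: as [nat] is countable, the preimage is a countable union of
    events [N = x] and [f x] in [A]. This handles sums with a random number of terms. *)
Lemma sigma_algebra_preimage_compose {T : Type} (S : set (set T))
    (N : T -> nat) (f : nat -> T -> nat) :
  sigma_algebra setT S -> (forall A, S (N @^-1` A)) ->
  (forall x A, S (f x @^-1` A)) ->
  forall A, S ((fun w => f (N w) w) @^-1` A).
Proof.
move=> sS SN Sf A.
have [//|_ _ _ SI] := (sigma_algebraP (U := setT) (C := S) _).1 sS.
have -> : (fun w => f (N w) w) @^-1` A =
    \bigcup_x (N @^-1` [set x] `&` f x @^-1` A).
  apply/seteqP; split=> [w /= Aw|w [x _ [/= ->]]//].
  by exists (N w).
by case: sS => _ _; apply=> x; apply: SI.
Qed.

Lemma sigma_algebra_preimage_add {T : Type} (S : set (set T)) (f g : T -> nat) :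
  sigma_algebra setT S -> (forall A, S (f @^-1` A)) ->
  (forall A, S (g @^-1` A)) ->
  forall A, S ((fun w => f w + g w)%N @^-1` A).
Proof.
move=> sS Sf Sg.
apply: (@sigma_algebra_preimage_compose T S f (fun x w => x + g w)%N sS Sf).
by move=> x A; exact: (Sg [set y | A (x + y)%N]).
Qed.

Lemma independent_of_generated {d d' : measure_display} {T : measurableType d}
    {T' : measurableType d'} {R : realType} (P : probability T R)
    (I : choiceType) (J : Type) (D D0 : set I) (E : set J)
    (X : I -> {RV P >-> T'}) (Y : J -> {RV P >-> T'}) (i0 : I) :
  mutually_independent D X -> independent_families D E X Y ->
  D0 `<=` D -> D i0 -> ~ D0 i0 ->
  forall (B : set T) (A : set T'),
  <<s \bigcup_(i in D0) preimage_set_system setT (X i) measurable `|`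
      \bigcup_(j in E) preimage_set_system setT (Y j) measurable >> B ->
  measurable A ->
  P (B `&` X i0 @^-1` A) = (P B * P (X i0 @^-1` A))%E.
Proof.
move=> Xind XYind D0D Di0 D0i0 B A.
set gen := (X in <<s X >>) => genB mA; set F := X i0 @^-1` A.
have mX i (A' : set T') : measurable A' -> measurable (X i @^-1` A').
  by move=> mA'; rewrite -[_ @^-1` _]setTI; apply: measurable_funP.
have mF : measurable F by exact: mX.
pose Z (s : seq I) (A' : I -> set T') : set T := \bigcap_(i in [set` s]) (X i @^-1` A' i).
pose Pi := [set B : set T | exists (s : seq I) (A' : I -> set T') C,
  [/\ uniq s, [set` s] `<=` D0, forall i, measurable (A' i),
      generated_sigma_algebra E Y C & B = Z s A' `&` C]].
have sD (s : seq I) : [set` s] `<=` D -> forall A', (forall i, measurable (A' i)) ->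
    generated_sigma_algebra D X (Z s A').
  move=> sD A' mA'; rewrite /Z bigcap_seq.
  have sa : sigma_algebra setT (generated_sigma_algebra D X).
    exact: smallest_sigma_algebra.
  have [//|GT _ _ GI] := (sigma_algebraP (U := setT) _).1 sa.
  elim: s sD => [|i s IH] sD; first by rewrite big_nil.
  rewrite big_cons; apply: GI; last first.
    by apply: IH => j js; apply: sD => /=; rewrite inE js orbT.
  apply: sub_sigma_algebra; exists i; first by apply: sD => /=; rewrite inE eqxx.
  by exists (A' i) => //; rewrite setTI.
have mC C : generated_sigma_algebra E Y C -> measurable C.
  apply: smallest_sub; first exact: sigma_algebra_measurable.
  by move=> _ [j _ [A' mA' <-]]; exact: measurable_funP.
have mZ (s : seq I) (A' : I -> set T') :
    (forall i, measurable (A' i)) -> measurable (Z s A').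
  move=> mA'; rewrite /Z bigcap_seq.
  by apply: bigsetI_measurable => i _; exact: mX.
pose H := [set B : set T | measurable B /\ P (B `&` F) = (P B * P F)%E].
have PiI : setI_closed Pi.
  move=> _ _ [s1 [A1 [C1 [u1 s1D mA1 gC1 ->]]]] [s2 [A2 [C2 [u2 s2D mA2 gC2 ->]]]].
  (* The two index lists are merged; a list that omits an index imposes the trivial constraint
     [setT] there. *)
  exists (undup (s1 ++ s2)).
  exists (fun i => (if i \in s1 then A1 i else setT) `&`
                   (if i \in s2 then A2 i else setT)), (C1 `&` C2); split.
  - exact: undup_uniq.
  - by move=> i /=; rewrite mem_undup mem_cat => /orP[/s1D|/s2D].
  - by move=> i; apply: measurableI; case: ifP.
  - have sa : sigma_algebra setT (generated_sigma_algebra E Y).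
      exact: smallest_sigma_algebra.
    by have [//|_ _ _ GI] := (sigma_algebraP (U := setT) _).1 sa; exact: GI.
  - apply/seteqP; split=> w.
      move=> [[z1 c1] [z2 c2]]; split=> // i /=.
      by move=> _; split; case: ifP => // ?; [exact: z1|exact: z2].
    move=> [z [c1 c2]]; split; split=> // i /= is_;
      by have /= := z i; rewrite mem_undup mem_cat is_ ?orbT => /(_ isT) [].
have PiH : Pi `<=` H.
  move=> _ [s [A' [C [us sD0 mA' gC ->]]]]; split.
    by apply: measurableI; [exact: mZ|exact: mC].
  have i0s : i0 \notin s by apply/negP => /sD0.
  have sDD : [set` s] `<=` D by exact: subset_trans D0D.
  (* Since [i0] is not in [s], changing the constraint at [i0] leaves [Z s A'] as it is and turns
     [Z s A']&[F] into one cylinder over [i0 :: s]. *)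
  pose A2 i := if i == i0 then A else A' i.
  have mA2 i : measurable (A2 i) by rewrite /A2; case: ifP.
  have sD2 : [set` i0 :: s] `<=` D.
    by move=> i /=; rewrite inE => /orP[/eqP->//|/sDD].
  have ZA2 : Z s A' = Z s A2.
    apply: eq_bigcapr => i /= is_; rewrite /A2; case: eqP => // ii0.
    by rewrite -ii0 is_ in i0s.
  have ZF : Z s A' `&` F = Z (i0 :: s) A2.
    rewrite ZA2 /Z !bigcap_seq big_cons setIC; congr (_ `&` _).
    by rewrite /A2 eqxx.
  (* First [C] is split off on both sides by independence of the families, then the two cylinders
     are compared by mutual independence within [X]. *)
  rewrite setIAC ZF XYind //; last exact: sD.
  rewrite XYind //; last exact: sD.
  rewrite ZA2 /Z !Xind //=; last by rewrite i0s.
  rewrite big_cons /A2 eqxx -/F -muleA muleC.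
  by congr (_ * _)%E.
have dynH : dynkin H.
  split.
  - by split; [exact: measurableT|rewrite setTI probability_setT mul1e].
  - move=> B' [mB' HB']; split; first exact: measurableC.
    rewrite probability_setC // setIC -setDE measureD //; last first.
      by rewrite ltey_eq fin_num_measure.
    transitivity (P F - P B' * P F)%E; last first.
      by rewrite muleBl ?mul1e //; exact: fin_num_measure.
    by congr (_ - _)%E; rewrite -HB' setIC.
  - move=> G tG HG; have mG n : measurable (G n) by case: (HG n).
    split; first exact: bigcupT_measurable.
    rewrite setI_bigcupl measure_bigcup //; last 2 first.
    + by move=> n _; exact: measurableI.
    + by under eq_fun do rewrite setIC; exact: trivIset_setIl.
    rewrite measure_bigcup //.
    rewrite muleC -[P F]fineK; last exact: fin_num_measure.
    rewrite -nneseriesZl; last by [].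
    apply: eq_eseriesr => n _; rewrite fineK; last exact: fin_num_measure.
    by case: (HG n) => _ HGn; exact: etrans HGn (muleC _ _).
have dHB : <<d Pi >> B.
  rewrite setI_closed_g_dynkin_g_sigma_algebra //.
  move: B genB; apply: smallest_sub; first exact: smallest_sigma_algebra.
  (* Each generator is in [Pi]: an event of some [X i] through a one-element list, an event of some
     [Y j] through the empty list. *)
  move=> B [[i D0i [A' mA' <-]]|[j Ej [A' mA' <-]]]; apply: sub_sigma_algebra.
  - exists [:: i], (fun=> A'), setT; split=> //.
    + by move=> k /=; rewrite inE => /eqP->.
    + by have [|] := (sigma_algebraP (U := setT) _).1
        (smallest_sigma_algebra setT (\bigcup_(j in E)
          preimage_set_system setT (Y j) measurable)).
    + by rewrite setIT setTI /Z bigcap_seq big_seq1.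
  - exists [::], (fun=> setT), (Y j @^-1` A'); split=> //.
    + by apply: sub_sigma_algebra; exists j => //; exists A' => //; rewrite setTI.
    + by rewrite setTI /Z bigcap_seq big_nil setTI.
by have [] : H B by exact: smallest_sub dynH PiH _ dHB.
Qed.

(** * Tail sums and the recursion for the means *)

Lemma eseries_eventually0 {R : realType} (u : nat -> \bar R) (n : nat) :
  (forall i, (n <= i)%N -> u i = 0%E) ->
  (\sum_(0 <= i <oo) u i = \sum_(0 <= i < n) u i)%E.
Proof.
move=> u0; apply/cvg_lim => //; apply: cvg_near_cst.
exists n => // k /= nk; rewrite (big_cat_nat (leq0n n) nk) /=.
by rewrite [X in (_ + X)%E]big_nat [X in (_ + X)%E]big1 ?adde0 // => i /andP[/u0].
Qed.

(** Write [N] as the sum over [i] of the indicators of [i < N] and integrate the nonnegative series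
    term by term. *)
Lemma ge0_integral_indic_mul_nat {d : measure_display} {T : measurableType d}
    {R : realType} (P : probability T R) (A : set T) (N : T -> nat) :
  measurable A -> (forall B, measurable (N @^-1` B)) ->
  (\int[P]_w (\1_A w * (N w)%:R)%:E =
   \sum_(0 <= i <oo) P (A `&` N @^-1` [set x | (i < x)%N]))%E.
Proof.
move=> mA mN.
pose f i w : \bar R := (\1_(A `&` N @^-1` [set x | (i < x)%N]) w)%:E.
have mf i : measurable (A `&` N @^-1` [set x | (i < x)%N]).
  by apply: measurableI.
transitivity (\int[P]_w (\sum_(0 <= i <oo) f i w))%E.
  apply: eq_integral => w _.
  rewrite (@eseries_eventually0 _ _ (N w)); last first.
    move=> i Ni; rewrite /f indicE; case: (boolP (_ \in _)) => //.
    by rewrite inE => -[_ /=]; rewrite ltnNge Ni.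
  rewrite sumEFin; congr (_%:E).
  rewrite (eq_big_nat _ _ (F2 := fun=> \1_A w)).
    by rewrite sumr_const_nat subn0 mulr_natr.
  move=> i /andP[_ iN]; rewrite !indicE in_setI; congr (_ _).
  by rewrite (mem_set (A := _ @^-1` _)) ?andbT.
rewrite integral_nneseries //.
- apply: eq_eseriesr => i _; rewrite /f integral_indic // ?setIT //.
- move=> i; apply/measurable_EFinP; exact: measurable_indic.
- by move=> i w _; rewrite lee_fin.
Qed.

Lemma expectation_natE {d : measure_display} {T : measurableType d}
    {R : realType} (P : probability T R) (N : T -> nat) :
  (forall B, measurable (N @^-1` B)) ->
  ('E_P[fun w => (N w)%:R] = \sum_(0 <= i <oo) P (N @^-1` [set x | (i < x)%N]))%E.
Proof.
move=> mN; rewrite unlock.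
under eq_eseriesr do rewrite -[X in P X]setTI.
rewrite -ge0_integral_indic_mul_nat //.
by apply: eq_integral => w _; rewrite indicT mul1r.
Qed.

Lemma measurable_natr {d : measure_display} {T : measurableType d}
    {R : realType} (N : T -> nat) :
  (forall B, measurable (N @^-1` B)) ->
  measurable_fun setT (fun w => (N w)%:R : R).
Proof.
by move=> mN _ B _; rewrite setTI; exact: (mN [set x | B x%:R]).
Qed.

Lemma preimage_RV_measurable {d d' : measure_display} {T : measurableType d}
    {T' : measurableType d'} {R : realType} (P : probability T R)
    (X : {RV P >-> T'}) (A : set T') :
  measurable A -> measurable (X @^-1` A).
Proof. by move=> mA; rewrite -[_ @^-1` _]setTI; apply: measurable_funP. Qed.

Section GaltonWatson_mean.
Context {d : measure_display} {T : measurableType d} {R : realType}.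
Context (P : probability T R) (xi : nat -> nat -> {RV P >-> nat}).
Context (Y : nat -> {RV P >-> nat}) (X : nat -> T -> nat).
Context (GW : GW_immigration xi Y X).

(** Keeping [S] arbitrary serves two purposes: with all measurable sets it gives measurability of
    [X k], with the sigma-algebra of the past it gives independence from the next generation. *)
Lemma GW_sigma_algebra (S : set (set T)) (k : nat) :
  sigma_algebra setT S ->
  (forall i j, (0 < i <= k)%N -> (0 < j)%N -> forall A, S (xi i j @^-1` A)) ->
  (forall i A, S (Y i @^-1` A)) ->
  forall A, S (X k @^-1` A).
Proof.
have [_ _ X0 XS] := GW; move=> sS; have [S0 SC _] := sS.
have Scst c A : S ((fun _ : T => c : nat) @^-1` A).
  rewrite preimage_cst; case: ifP => // _.
  by rewrite -[setT]setD0; exact: SC.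
elim: k => [_ _ A|k IH Sxi SY].
  by rewrite (_ : X 0 = fun=> 0%N); [exact: Scst|apply/funext].
have -> : X k.+1 = fun w => (\sum_(1 <= j < (X k w).+1) xi k.+1 j w + Y k w)%N.
  by apply/funext => w; rewrite XS.
apply: sigma_algebra_preimage_add => //.
apply: (@sigma_algebra_preimage_compose _ _ (X k)
  (fun x w => \sum_(1 <= j < x.+1) xi k.+1 j w)%N) => //.
  by apply: IH => // i j /andP[i0 ik]; apply: Sxi; rewrite i0 ltnW.
move=> x; elim: x => [|x IHx] A.
  by under eq_fun do rewrite big_geq//; exact: Scst.
under eq_fun do rewrite big_nat_recr//=.
by apply: sigma_algebra_preimage_add => //; apply: Sxi; rewrite ?leqnn.
Qed.

Lemma GW_measurable (k : nat) (A : set nat) : measurable (X k @^-1` A).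
Proof.
apply: GW_sigma_algebra => //; first exact: sigma_algebra_measurable.
- by move=> *; exact: preimage_RV_measurable.
- by move=> *; exact: preimage_RV_measurable.
Qed.

(** [X k] is a function of the immigration and of the offspring variables of generations [1] to [k],
    and the index [(k.+1, j.+1)] lies outside these. *)
Lemma GW_independent_next (k j : nat) (A B : set nat) :
  P (X k @^-1` A `&` xi k.+1 j.+1 @^-1` B) =
  (P (X k @^-1` A) * P (xi k.+1 j.+1 @^-1` B))%E.
Proof.
have [[xi_ind _] xiY _ _] := GW.
apply: (independent_of_generated P _ _ _
  [set kj : nat * nat | (0 < kj.1 <= k)%N /\ (0 < kj.2)%N] _ _ _ (k.+1, j.+1)
  xi_ind xiY) => //.
- by move=> [i l] [/andP[i0 _] l0].
- by move=> [/andP[_]]; rewrite ltnn.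
- apply: GW_sigma_algebra; first exact: smallest_sigma_algebra.
  + move=> i l ik l0 A'; apply: sub_sigma_algebra; left.
    by exists (i, l) => //; exists A' => //; rewrite setTI.
  + move=> i A'; apply: sub_sigma_algebra; right.
    by exists i => //; exists A' => //; rewrite setTI.
Qed.

Lemma GW_expectation0 : 'E_P[fun w => (X 0%N w)%:R]%E = 0%E.
Proof.
have [_ _ X0 _] := GW; rewrite unlock.
by under eq_integral do rewrite X0; rewrite integral0.
Qed.

(** Wald's identity: the random sum is the series over [j] of the indicator of [j < X k] times
    [xi k.+1 j.+1]. Each term has mean [P (A j)] times the offspring mean by independence, and the
    [P (A j)] add up to the mean of [X k]. *)
Lemma GW_expectationS (k : nat) :
  ('E_P[fun w => (xi 1%N 1%N w)%:R] < +oo)%E ->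
  ('E_P[fun w => (X k.+1 w)%:R] =
   'E_P[fun w => (xi 1%N 1%N w)%:R] * 'E_P[fun w => (X k w)%:R]
   + 'E_P[fun w => (Y k w)%:R])%E.
Proof.
have [[_ xi_id] _ _ XS] := GW; move=> xi_fin.
have mxi i j A : measurable (xi i j @^-1` A) by exact: preimage_RV_measurable.
pose A j := X k @^-1` [set x | (j < x)%N].
pose g j w : \bar R := (\1_(A j) w * (xi k.+1 j.+1 w)%:R)%:E.
have mA j : measurable (A j) by exact: GW_measurable.
have g0 j w : (0 <= g j w)%E by rewrite lee_fin mulr_ge0.
have mg j : measurable_fun setT (g j).
  apply/measurable_EFinP; apply: measurable_funM.
    exact: measurable_indic.
  exact: measurable_natr.
have intg j : (\int[P]_w g j w = P (A j) * 'E_P[fun w => (xi 1%N 1%N w)%:R])%E.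
  rewrite ge0_integral_indic_mul_nat // expectation_natE //.
  rewrite -[P (A j)]fineK; last exact: fin_num_measure.
  rewrite -nneseriesZl //.
  apply: eq_eseriesr => i _; rewrite fineK; last exact: fin_num_measure.
  rewrite GW_independent_next; congr (_ * _)%E.
  exact: (xi_id k.+1 j.+1 isT isT [set x | (i < x)%N]).
transitivity (\int[P]_w (\sum_(0 <= j <oo) g j w + (Y k w)%:R%:E))%E.
  rewrite unlock; apply: eq_integral => w _.
  rewrite (@eseries_eventually0 _ _ (X k w)); last first.
    move=> j Xj; rewrite /g indicE memNset ?mul0r //=.
    by apply/negP; rewrite -leqNgt.
  rewrite XS natrD EFinD; congr (_ + _)%E.
  (* The offspring are numbered from [1], the series from [0]. *)
  rewrite sumEFin big_add1 /= natr_sum; congr _%:E.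
  apply: eq_big_nat => j /andP[_ jX].
  by rewrite indicE mem_set ?mul1r.
rewrite ge0_integralD //; last 3 first.
- by move=> w _; exact: nneseries_ge0.
- exact: ge0_emeasurable_sum.
- apply/measurable_EFinP; apply: measurable_natr.
  by move=> B; exact: preimage_RV_measurable.
rewrite integral_nneseries //; congr (_ + _)%E; last by rewrite unlock.
under eq_eseriesr do rewrite intg.
rewrite [in RHS](expectation_natE P (X k)) //; last exact: GW_measurable.
have E0 : (0 <= 'E_P[fun w => (xi 1%N 1%N w)%:R])%E.
  by rewrite unlock; apply: integral_ge0 => w _; rewrite lee_fin.
under eq_eseriesr do rewrite muleC.
rewrite -[('E_P[fun w => (xi 1%N 1%N w)%:R])%E]fineK ?ge0_fin_numE //.
by rewrite nneseriesZl.
Qed.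
End GaltonWatson_mean.

Lemma expectation_nat_ge0 {d : measure_display} {T : measurableType d}
    {R : realType} (P : probability T R) (N : T -> nat) :
  (0 <= 'E_P[fun w => (N w)%:R])%E.
Proof. by rewrite unlock; apply: integral_ge0 => w _; rewrite lee_fin. Qed.

Lemma expectation_natZ {d : measure_display} {T : measurableType d}
    {R : realType} (P : probability T R) (c : R) (N : {RV P >-> nat}) :
  0 <= c ->
  ('E_P[fun w => (c * (N w)%:R)%R] = c%:E * 'E_P[fun w => (N w)%:R])%E.
Proof.
move=> c0; rewrite unlock -ge0_integralZl_EFin //.
by apply/measurable_EFinP; apply: measurable_natr => B; exact: preimage_RV_measurable.
Qed.

Lemma GW_expectation_fin_num {d : measure_display} {T : measurableType d}
    {R : realType} (P : probability T R) (xi : nat -> nat -> {RV P >-> nat})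
    (Y : nat -> {RV P >-> nat}) (X : nat -> T -> nat) :
  GW_immigration xi Y X ->
  ('E_P[fun w => (xi 1%N 1%N w)%:R] < +oo)%E ->
  (forall k, ('E_P[fun w => (Y k w)%:R] < +oo)%E) ->
  forall k, ('E_P[fun w => (X k w)%:R] \is a fin_num)%E.
Proof.
move=> GW xi_fin Y_fin; elim=> [|k IH]; first by rewrite (GW_expectation0 _ _ _ _ GW).
rewrite (GW_expectationS _ _ _ _ GW) // fin_numD fin_numM //=.
  by rewrite ge0_fin_numE ?expectation_nat_ge0.
by rewrite ge0_fin_numE ?expectation_nat_ge0.
Qed.

(** * Skorokhod convergence and cadlag functions *)

Lemma cvg_sup_dist_near {R : realType} (A : set R) (f_ : nat -> R -> \bar R)
    (f : R -> R) :
  sup_dist A (f_ n) f @[n --> \oo] --> 0%E ->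
  forall e, 0 < e ->
  \forall n \near \oo, forall t, A t -> (`|f_ n t - (f t)%:E| <= e%:E)%E.
Proof.
move=> /fine_cvgP[Ffin /cvgr_lt F0] e e0; near=> n => t At.
have Fn : sup_dist A (f_ n) f \is a fin_num by near: n.
have : fine (sup_dist A (f_ n) f) < e by near: n; exact: F0.
rewrite -lte_fin fineK // => /ltW; apply: le_trans.
by apply: ereal_sup_ubound; exists t.
Unshelve. all: by end_near. Qed.

(** A point of [A] makes the supremum nonnegative; over the empty set it would be [-oo]. *)
Lemma near_cvg_sup_dist {R : realType} (A : set R) (f_ : nat -> R -> \bar R)
    (f : R -> R) :
  A !=set0 ->
  (forall e, 0 < e ->
   \forall n \near \oo, forall t, A t -> (`|f_ n t - (f t)%:E| <= e%:E)%E) ->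
  sup_dist A (f_ n) f @[n --> \oo] --> 0%E.
Proof.
move=> [a Aa] near_f.
have ge0 n : (0 <= sup_dist A (f_ n) f)%E.
  apply: (le_trans (abse_ge0 (f_ n a - (f a)%:E)%E)).
  by apply: ereal_sup_ubound; exists a.
have le_e e : 0 < e -> \forall n \near \oo, (sup_dist A (f_ n) f <= e%:E)%E.
  move=> e0; apply: filterS (near_f e e0) => n fe.
  by apply: ge_ereal_sup => _ [t At <-]; exact: fe.
apply/fine_cvgP; split.
  apply: filterS (le_e 1 ltr01) => n le1.
  by rewrite ge0_fin_numE //; apply: le_lt_trans le1 (ltry _).
apply/cvgrPdist_le => e e0; apply: filterS (le_e e e0) => n ne.
rewrite /= sub0r normrN ger0_norm ?fine_ge0 //.
by rewrite -lee_fin fineK // ge0_fin_numE //; apply: le_lt_trans ne (ltry _).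
Qed.

(** Intermediate value theorem between [lam 0 = 0] and a point where [lam], which tends to infinity,
    exceeds [s]. *)
Lemma time_change_surjective {R : realType} (lam : R -> R) (s : R) :
  time_change lam -> 0 <= s -> exists2 u, 0 <= u & lam u = s.
Proof.
move=> [lam_cont _ lam0 /cvgryPge lam_oo] s0.
have : \forall t \near +oo, 0 <= t /\ s <= lam t.
  near=> t; split; near: t; first exact: nbhs_pinfty_ge.
  exact: lam_oo.
move=> /filter_ex [b [b0 sb]].
have [||u] := @IVT R lam 0 b s b0.
- apply: continuous_subspaceW lam_cont.
  by move=> x /=; rewrite !in_itv /= => /andP[-> _].
- by rewrite lam0 ge_min s0 le_max sb orbT.
- by rewrite in_itv /= => /andP[u0 _] <-; exists u.
Unshelve. all: by end_near. Qed.

(* [u] is the point sent to [s] by the time change. *)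
Lemma cvg_J1_nearby {R : realType} (f_ : nat -> R -> \bar R) (f : R -> R) :
  cvg_J1 f_ f -> forall T e, 0 <= T -> 0 < e ->
  \forall n \near \oo, forall s, 0 <= s <= T ->
  exists u, [/\ 0 <= u <= T + 1, `|u - s| <= e &
                (`|f_ n s - (f u)%:E| <= e%:E)%E].
Proof.
move=> [lam [lam_tc /cvg_sup_dist_near lam_id lam_f]] T e T0 e0.
(* The cap [1] keeps the preimage [u] of [s] in [[0, T + 1]], the segment on which the uniform
   convergence along [lam] is used. *)
have e10 : 0 < Num.min e 1 by rewrite lt_min e0 ltr01.
have T10 : 0 < T + 1 by rewrite ltr_wpDl.
near=> n => s /andP[s0 sT].
have [u u0 lamu] := time_change_surjective _ _ (lam_tc n) s0.
have us : `|u - s| <= Num.min e 1.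
  rewrite -lamu distrC -lee_fin.
  suff H : forall t, `[0, +oo[%classic t ->
      (`|(lam n t)%:E - (id t)%:E| <= (Num.min e 1)%:E)%E.
    by apply: H; rewrite /= in_itv /= u0.
  by near: n; exact: lam_id.
have [use us1] : `|u - s| <= e /\ `|u - s| <= 1.
  by move: us; rewrite le_min => /andP.
have uT : 0 <= u <= T + 1 by rewrite u0 /=; move: us1; rewrite ler_norml; lra.
exists u; split => //; rewrite -lamu.
suff H : forall t, `[0, T + 1]%classic t ->
    (`|f_ n (lam n t) - (f t)%:E| <= e%:E)%E.
  by apply: H; rewrite /= in_itv.
by near: n; exact: (cvg_sup_dist_near _ _ _ (lam_f _ T10)).
Unshelve. all: by end_near. Qed.

(** * Compactness of segments, uniform continuity and one-sided control of cadlag functions *)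

Lemma segment_finite_cover {R : realType} (a b : R) (eta : R -> R) :
  (forall t, 0 < eta t) ->
  exists2 s : seq R, (forall t, t \in s -> a <= t <= b) &
    forall u, a <= u <= b -> exists2 t, t \in s & `|u - t| < eta t.
Proof.
move=> eta0; have := @segment_compact R a b; rewrite compact_cover.
move=> /(_ R `[a, b]%classic (fun t => ball t (eta t))) [||s sab scov].
- by move=> t _; exact: ball_open.
- by move=> t abt; exists t => //; exact: ballxx.
- exists (finmap.enum_fset s).
    by move=> t ts; have := sab t ts; rewrite inE /= in_itv.
  move=> u abu; have [|t ts ut] := scov u; first by rewrite /= in_itv.
  by exists t => //; rewrite distrC.
Qed.

Lemma seq_common_lower_bound {R : realType} (I : eqType) (s : seq I)
    (eta : I -> R) :
  (forall t, 0 < eta t) -> exists2 dl, 0 < dl & forall t, t \in s -> dl <= eta t.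
Proof.
move=> eta0; elim: s => [|i s [dl dl0 IH]]; first by exists 1.
exists (Num.min (eta i) dl) => [|t]; first by rewrite lt_min eta0.
by rewrite inE ge_min => /orP[/eqP->|/IH ->]; rewrite ?lexx ?orbT.
Qed.

Lemma seq_common_upper_bound {R : realType} (I : eqType) (s : seq I)
    (M : I -> R) : exists B, forall t, t \in s -> M t <= B.
Proof.
elim: s => [|i s [B IH]]; first by exists 0.
exists (Num.max (M i) B) => t.
by rewrite inE le_max => /orP[/eqP->|/IH ->]; rewrite ?lexx ?orbT.
Qed.

Lemma uniformly_continuous_segment {R : realType} (f : R -> R) (T e : R) :
  {within `[0, +oo[, continuous f} -> 0 < e ->
  exists2 dl, 0 < dl & forall u v, 0 <= u <= T -> 0 <= v ->
    `|u - v| <= dl -> `|f u - f v| <= e.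
Proof.
move=> fcont e0.
have e20 : 0 < e / 2 by rewrite divr_gt0.
have loc t : exists dl, 0 < dl /\ (0 <= t -> forall v, 0 <= v ->
    `|v - t| < dl -> `|f v - f t| <= e / 2).
  have [t0|t0] := leP 0 t; last first.
    by exists 1; split => // t0'; move: t0; rewrite ltNge t0'.
  have /subspace_continuousP/(_ t) fct := fcont.
  have /fct/cvgrPdistC_le/(_ _ e20) : `[0, +oo[%classic t.
    by rewrite /= in_itv /= t0.
  rewrite near_withinE => /nbhs_ballP[dl dl0 fdl].
  exists dl; split => // _ v v0 vt; apply: fdl; first by rewrite /ball /= distrC.
  by rewrite /= in_itv /= v0.
have [eta eta_loc] := choice loc.
have eta0 t : 0 < eta t / 2 by rewrite divr_gt0 //; case: (eta_loc t).
(* Covering with half the radii leaves room for [v]: if [u] is within [eta t / 2] of [t] and [v]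
   within [dl <= eta t / 2] of [u], then both are within [eta t] of [t]. *)
have [s sT scov] := segment_finite_cover 0 T (fun t => eta t / 2) eta0.
have [dl dl0 dls] := seq_common_lower_bound _ s (fun t => eta t / 2) eta0.
exists dl => // u v uT v0 uv; have [t ts ut] := scov u uT.
have [_ ft] := eta_loc t; have /andP[t0 _] := sT t ts; have {}ft := ft t0.
have fu : `|f u - f t| <= e / 2.
  by apply: ft; [case/andP: uT|apply: lt_le_trans ut _; have := eta0 t; lra].
have fv : `|f v - f t| <= e / 2.
  apply: ft => //; have dlt := dls t ts.
  rewrite -(subrK u v) -addrA; apply: le_lt_trans (ler_normD _ _) _.
  by rewrite distrC; lra.
rewrite -(subrK (f t) (f u)) -addrA; apply: le_trans (ler_normD _ _) _.
by rewrite [`|f t - _|]distrC; lra.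
Qed.

(** Here [l] is the left limit at [t]: near [t], the function is almost constant on each side
    separately. *)
Lemma cadlag_local {R : realType} (f : R -> R) (t e : R) :
  cadlag f -> 0 <= t -> 0 < e ->
  exists eta l, 0 < eta /\ forall u, 0 <= u -> `|u - t| < eta ->
    (u < t -> `|f u - l| <= e) /\ (t <= u -> `|f u - f t| <= e).
Proof.
move=> [fr fl] t0 e0.
have [eta1 eta10 f1] : exists2 eta1, 0 < eta1 & forall u,
    `|u - t| < eta1 -> t <= u -> `|f u - f t| <= e.
  have /cvgrPdistC_le/(_ _ e0) := fr t t0.
  rewrite near_withinE => /nbhs_ballP[dl dl0 fdl]; exists dl => // u ut.
  rewrite le_eqVlt => /orP[/eqP <-|tu]; first by rewrite subrr normr0 ltW.
  by apply: fdl => //; rewrite /ball /= distrC.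
have [l [eta2 eta20 f2]] : exists l, exists2 eta2, 0 < eta2 & forall u,
    0 <= u -> `|u - t| < eta2 -> u < t -> `|f u - l| <= e.
  have [{}t0|t00] := ltP 0 t; last first.
    (* At [t = 0] no admissible [u] lies to the left, so [l] is a dummy value. *)
    by exists 0, 1 => // u u0 _ ut; move: (lt_le_trans ut t00); rewrite ltNge u0.
  have /cvg_ex[l /cvgrPdistC_le/(_ _ e0)] := fl t t0.
  rewrite near_withinE => /nbhs_ballP[dl dl0 fdl]; exists l, dl => // u _ ut u_t.
  by apply: fdl => //; rewrite /ball /= distrC.
exists (Num.min eta1 eta2), l; split; first by rewrite lt_min eta10.
by move=> u u0; rewrite lt_min => /andP[ut1 ut2]; split => ?; [exact: f2|exact: f1].
Qed.

(** By compactness finitely many of the neighbourhoods from [cadlag_local] suffice; boundedness and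
    the scarcity of large jumps both follow from this. *)
Lemma cadlag_finite_cover {R : realType} (f : R -> R) (T e : R) :
  cadlag f -> 0 < e ->
  exists (s : seq R) (eta l : R -> R), (forall t, 0 < eta t) /\
    forall u, 0 <= u <= T -> exists t, [/\ t \in s, 0 <= t <= T, `|u - t| < eta t &
      forall v, 0 <= v -> `|v - t| < eta t ->
        (v < t -> `|f v - l t| <= e) /\ (t <= v -> `|f v - f t| <= e)].
Proof.
move=> fcl e0.
have loc t : exists etal : R * R, 0 < etal.1 /\ (0 <= t -> forall u, 0 <= u ->
    `|u - t| < etal.1 ->
    (u < t -> `|f u - etal.2| <= e) /\ (t <= u -> `|f u - f t| <= e)).
  have [t0|t0] := leP 0 t; last first.
    by exists (1, 0); split => //; rewrite leNgt t0.
  have [eta [l [eta0 H]]] := cadlag_local f t e fcl t0 e0.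
  by exists (eta, l).
have [etal etalP] := choice loc.
have eta0 t : 0 < (etal t).1 by case: (etalP t).
have [s sT scov] := segment_finite_cover 0 T (fun t => (etal t).1) eta0.
exists s, (fun t => (etal t).1), (fun t => (etal t).2); split => // u /scov[t ts ut].
have tT := sT t ts; exists t; split => //.
by case: (etalP t) => _; apply; case/andP: tT.
Qed.

Lemma cadlag_bounded {R : realType} (f : R -> R) (T : R) :
  cadlag f -> exists2 M, 0 <= M & forall u, 0 <= u <= T -> `|f u| <= M.
Proof.
move=> fcl; have [s [eta [l [eta0 scov]]]] := cadlag_finite_cover f T 1 fcl ltr01.
have [M sM] := seq_common_upper_bound _ s (fun t => `|l t| + `|f t| + 1).
exists `|M| => // u uT; have [t [ts _ ut Ht]] := scov u uT.
apply: le_trans (ler_norm M); apply: le_trans (sM t ts).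
have [u0 _] := andP uT; have [Hl Hr] := Ht u u0 ut.
have Nl : 0 <= `|l t| by []. have Nf : 0 <= `|f t| by [].
have [/Hl H|/Hr H] := ltP u t.
- by rewrite -(subrK (l t) (f u)); apply: le_trans (ler_normD _ _) _; lra.
- by rewrite -(subrK (f t) (f u)); apply: le_trans (ler_normD _ _) _; lra.
Qed.

(** Jumps larger than [e] can occur only at the centres of the finite cover: elsewhere [u] and the
    points close to it lie on the same side of a centre, where [f] stays within [e / 2] of a single
    value. *)
Lemma cadlag_finite_large_jumps {R : realType} (f : R -> R) (T e : R) :
  cadlag f -> 0 < e ->
  exists s : seq R, forall u, 0 <= u <= T -> u \notin s ->
    exists2 dl, 0 < dl & forall v, 0 <= v -> `|v - u| < dl -> `|f v - f u| <= e.
Proof.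
move=> fcl e0; have e20 : 0 < e / 2 by rewrite divr_gt0.
have [s [eta [l [eta0 scov]]]] := cadlag_finite_cover f T (e / 2) fcl e20.
exists s => u uT us; have [t [ts _ ut Ht]] := scov u uT.
have [u0 _] := andP uT.
have ut0 : 0 < `|u - t|.
  by rewrite normr_gt0 subr_eq0; apply: contraNneq us => ->.
(* The first bound keeps [v] on the same side of [t] as [u], the second keeps it in the ball around
   [t]. *)
exists (Num.min `|u - t| (eta t - `|u - t|)).
  by rewrite lt_min ut0 subr_gt0.
move=> v v0; rewrite lt_min => /andP[vu1 vu2].
have vt : `|v - t| < eta t.
  by rewrite -(subrK u v) -addrA; apply: le_lt_trans (ler_normD _ _) _; lra.
have [Hul Hur] := Ht u u0 ut; have [Hvl Hvr] := Ht v v0 vt.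
have [u_t|t_u] := ltP u t.
- have v_t : v < t.
    by move: vu1; rewrite (ltr0_norm (x := u - t)) ?subr_lt0 // ltr_norml; lra.
  have {}Hul := Hul u_t; have {}Hvl := Hvl v_t.
  by rewrite -(subrK (l t) (f v)) -addrA; apply: le_trans (ler_normD _ _) _;
    rewrite [`|l t - _|]distrC; lra.
- have t_v : t <= v.
    by move: vu1; rewrite (ger0_norm (x := u - t)) ?subr_ge0 // ltr_norml; lra.
  have {}Hur := Hur t_u; have {}Hvr := Hvr t_v.
  by rewrite -(subrK (f t) (f v)) -addrA; apply: le_trans (ler_normD _ _) _;
    rewrite [`|f t - _|]distrC; lra.
Qed.

(** * The subcritical recursion *)

(** [f_ n s] is close to [f u] for some [u] near [s], and uniform continuity on [[0, T + 1]]
    replaces [f u] by [f s]. *)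
Lemma cvg_J1_continuous {R : realType} (f_ : nat -> R -> \bar R) (f : R -> R) :
  cvg_J1 f_ f -> {within `[0, +oo[, continuous f} -> cvg_locally_uniformly f_ f.
Proof.
move=> fJ1 fcont T T0; apply: near_cvg_sup_dist.
  by exists 0; rewrite /= in_itv /= lexx.
move=> e e0; have e20 : 0 < e / 2 by rewrite divr_gt0.
have [dl dl0 fdl] := uniformly_continuous_segment f (T + 1) (e / 2) fcont e20.
have m0 : 0 < Num.min dl (e / 2) by rewrite lt_min dl0.
have := cvg_J1_nearby f_ f fJ1 T (Num.min dl (e / 2)) T0 m0.
apply: filterS => n near_n s; rewrite /= in_itv /= => sT.
have [u [uT us fu]] := near_n s sT.
move: us fu; rewrite le_min => /andP[us _].
have [s0 _] := andP sT; have fus := fdl u s uT s0 us.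
case: (f_ n s) => [r| |] //=; rewrite !lee_fin le_min => /andP[_ rfu].
by rewrite -(subrK (f u) r) -addrA; apply: le_trans (ler_normD _ _) _; lra.
Qed.

(* The error [e_k = x_k - (1 - a)^-1 beta (k / n)] satisfies
   [e_(k+1) = a_n e_k + r_k] with [r_k] uniformly small. *)
Lemma subcritical_recursion_limit {R : realType} (a : R) (a_ : nat -> R)
    (x y : nat -> nat -> R) (beta : R -> R) :
  0 <= a < 1 -> (forall n, 0 <= a_ n) -> a_ n @[n --> \oo] --> a ->
  (forall n, (0 < n)%N -> x n 0%N = 0) ->
  (forall n k, (0 < n)%N -> x n k.+1 = a_ n * x n k + y n k) ->
  cadlag beta -> {within `[0, +oo[, continuous beta} -> beta 0 = 0 ->
  (forall T e : R, 0 <= T -> 0 < e -> \forall n \near \oo, forall s : R, 0 <= s <= T ->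
     `|y n (Num.truncn (n%:R * s)) - beta s| <= e) ->
  forall T e : R, 0 <= T -> 0 < e -> \forall n \near \oo, forall t : R, 0 <= t <= T ->
     `|x n (Num.truncn (n%:R * t)) - (1 - a)^-1 * beta t| <= e.
Proof.
move=> /andP[a0 a1] a_0 a_a x0 xS bcl bcont b0 ybeta T e T0 e0.
pose c := (1 - a)^-1.
have c0 : 0 < c by rewrite invr_gt0 subr_gt0.
have cE : c * (1 - a) = 1 by rewrite mulVf // gt_eqF // subr_gt0.
have [M M0 bM] := cadlag_bounded beta T bcl.
(* The constants are such that [c * e2 = e1] and [3 * e1 = (1 - a) / 2 * (e / 2)]: three source
   terms of size [e1] are exactly what a contraction by [(1 + a) / 2] leaves free in the bound
   [e / 2]. *)
pose e1 := e / 12 * (1 - a).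
have e10 : 0 < e1 by rewrite mulr_gt0 ?divr_gt0 // subr_gt0.
pose e2 := e1 * (1 - a).
have e20 : 0 < e2 by rewrite mulr_gt0 // subr_gt0.
have [dl dl0 bdl] := uniformly_continuous_segment beta T e2 bcont e20.
(* The first entry gives [a_ n <= (1 + a) / 2], the second bounds [(a_ n - a) * beta] by [e2];
   [M + 1] is a positive divisor even if [M = 0]. *)
pose e3 := Num.min ((1 - a) / 2) (e2 / (M + 1)).
have e30 : 0 < e3.
  by rewrite lt_min !divr_gt0 // ?subr_gt0 // ltr_wpDl.
near=> n.
have n0 : (0 < n)%N by near: n; exact: nbhs_infty_gt.
have nR0 : (0 : R) < n%:R by rewrite ltr0n.
have ndl : n%:R^-1 <= dl.
  rewrite invf_ple ?posrE //; near: n; exact: nbhs_infty_ger.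
have aa : `|a_ n - a| <= e3 by near: n; move/cvgrPdistC_le: a_a; exact.
have ay : forall s, 0 <= s <= T -> `|y n (Num.truncn (n%:R * s)) - beta s| <= e1.
  by near: n; exact: ybeta.
have [aa1 aa2] : `|a_ n - a| <= (1 - a) / 2 /\ `|a_ n - a| * (M + 1) <= e2.
  move: aa; rewrite le_min => /andP[-> aa2]; split => //.
  by rewrite -ler_pdivlMr // ltr_wpDl.
have trunc_k k : Num.truncn (n%:R * (k%:R / n%:R) : R) = k.
  by rewrite mulrC divfK ?gt_eqF // natrK.
have err k : k%:R / n%:R <= T -> `|x n k - c * beta (k%:R / n%:R)| <= e / 2.
  elim: k => [|k IH] kT.
    (* The initial error vanishes because [beta 0 = 0]. *)
    by rewrite x0 // mul0r b0 mulr0 subr0 normr0 divr_ge0 // ltW.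
  have k0 : 0 <= k%:R / n%:R :> R by rewrite divr_ge0.
  have kk : k%:R / n%:R <= k.+1%:R / n%:R :> R.
    by rewrite ler_pM2r ?invr_gt0 // ler_nat.
  have kT' : k%:R / n%:R <= T by exact: le_trans kT.
  have {}IH := IH kT'.
  have kT2 : 0 <= (k%:R / n%:R : R) <= T by rewrite k0.
  have := ay _ kT2; rewrite trunc_k => yk.
  have bk : `|beta (k%:R / n%:R) - beta (k.+1%:R / n%:R)| <= e2.
    apply: (bdl _ _ kT2); first exact: (le_trans k0 kk).
    rewrite distrC -mulrBl -natrB // subSnn mul1r ger0_norm // invr_ge0 ltW //.
  have bMk := bM _ kT2.
  rewrite xS //.
  set b := beta (k%:R / n%:R) in yk bk bMk IH *.
  set b' := beta (k.+1%:R / n%:R) in bk *.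
  (* As [c * (1 - a) = 1], [c * b] is the fixed point of the map sending [z] to [a * z + b]; the
     last three terms are the errors from [y], from [a_ n] and from the move to the next grid
     point. *)
  have -> : a_ n * x n k + y n k - c * b' =
      a_ n * (x n k - c * b) + (y n k - b) + c * ((a_ n - a) * b) + c * (b - b').
    have : c * (1 - a) * b = b by rewrite cE mul1r.
    by move=> h; rewrite -{2}h; ring.
  have h1 : `|a_ n * (x n k - c * b)| <= (1 + a) / 2 * (e / 2).
    rewrite normrM ler_pM // ger0_norm //; move: aa1; rewrite ler_norml; lra.
  have h2 : `|c * ((a_ n - a) * b)| <= e1.
    have -> : e1 = c * e2 by rewrite /e2 mulrCA cE mulr1.
    rewrite normrM gtr0_norm // ler_pM2l // normrM; apply: le_trans aa2.
    by rewrite ler_wpM2l //; lra.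
  have h3 : `|c * (b - b')| <= e1.
    have -> : e1 = c * e2 by rewrite /e2 mulrCA cE mulr1.
    by rewrite normrM gtr0_norm // ler_pM2l.
  have e1E : 3 * e1 = (1 - a) / 2 * (e / 2) by rewrite /e1; field.
  apply: le_trans (ler_normD _ _) _.
  apply: le_trans (lerD (ler_normD _ _) h3) _.
  apply: le_trans (lerD (lerD (ler_normD _ _) h2) (lexx _)) _.
  apply: le_trans (lerD (lerD (lerD h1 yk) (lexx _)) (lexx _)) _.
  by rewrite [leRHS](_ : _ = (1 + a) / 2 * (e / 2) + (1 - a) / 2 * (e / 2));
    [rewrite -e1E; lra|field].
(* From grid points to all [t]: [k / n] is within [1 / n <= dl] of [t], which costs at most
   [e1 <= e / 2] more. *)
move=> t /andP[t0 tT]; set k := Num.truncn (n%:R * t).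
have /andP[kt tk] := truncn_itv (mulr_ge0 (ltW nR0) t0).
have kt' : k%:R / n%:R <= t by rewrite ler_pdivrMr // mulrC.
have tk' : t <= k%:R / n%:R + n%:R^-1.
  by rewrite -[X in _ + X]mul1r -mulrDl natr1 ler_pdivlMr // mulrC ltW.
have h1 := err k (le_trans kt' tT).
have h2 : `|c * (beta (k%:R / n%:R) - beta t)| <= e1.
  have -> : e1 = c * e2 by rewrite /e2 mulrCA cE mulr1.
  rewrite normrM gtr0_norm // ler_pM2l //; apply: bdl => //.
    by apply/andP; split; [rewrite divr_ge0|exact: le_trans kt' tT].
  by rewrite distrC ger0_norm ?subr_ge0 // lerBlDl (le_trans tk') // lerD2l.
have e1e : e1 <= e / 2.
  have : e / 12 * (1 - a) <= e / 12 * 1 by rewrite ler_pM2l ?divr_gt0 //; lra.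
  by rewrite /e1; lra.
have -> : x n k - c * beta t =
    (x n k - c * beta (k%:R / n%:R)) + c * (beta (k%:R / n%:R) - beta t) by ring.
by apply: le_trans (ler_normD _ _) _; lra.
Unshelve. all: by end_near. Qed.

(** * The nearly critical recursion *)

Lemma measurable_comp_truncn {R : realType} (D : set R) (n : nat) (h : nat -> R) :
  measurable_fun D (fun s => h (Num.truncn (n%:R * s))).
Proof.
apply: measurable_funS (subsetT D) _ => //.
have mtr : measurable_fun [set: R] (Num.truncn : R -> nat).
  move=> _ A _; rewrite setTI.
  (* The fibre over [k] is [[k, k + 1)], except that the fibre over [0] contains all negative
     numbers too; hence the guard [0 < k]. *)
  have -> : Num.truncn @^-1` A = \bigcup_(k in A)
      ([set s : R | s < k.+1%:R] `&` ~` [set s : R | (0 < k)%N /\ s < k%:R]).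
    apply/seteqP; split=> [s /= As|s [k Ak [/= sk ks]]].
      exists (Num.truncn s) => //; split => /=; first exact: truncnS_gt.
      move=> [k0 sk]; have : (Num.truncn s <= (Num.truncn s).-1)%N.
        by rewrite truncn_le_nat prednK.
      by rewrite leqNgt ltn_predL k0.
    suff -> : Num.truncn s = k by [].
    apply/eqP; rewrite eqn_leq truncn_le_nat sk /=.
    case: k {Ak sk} ks => // k ks; rewrite ltnNge truncn_le_nat.
    by apply/negP => sk; apply: ks.
  apply: bigcup_measurable => k _; apply: measurableI.
    by rewrite (_ : [set _ | _] = `]-oo, k.+1%:R[%classic).
  apply: measurableC; case: k => [|k].
    by rewrite (_ : [set _ | _] = set0) //; apply/seteqP; split => s // [].
  rewrite (_ : [set _ | _] = `]-oo, k.+1%:R[%classic) //.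
  by apply/seteqP; split => s /=; rewrite in_itv //= => -[].
have mh : measurable_fun [set: nat] h by [].
have mm : measurable_fun [set: R] (fun s : R => n%:R * s).
  exact: mulrl_measurable.
exact: (measurableT_comp mh (measurableT_comp mtr mm)).
Qed.

Lemma cvg_truncnS {R : realType} (s : R) : 0 <= s ->
  forall e, 0 < e -> \forall n \near \oo,
  s < (Num.truncn (n%:R * s)).+1%:R / n%:R <= s + e.
Proof.
move=> s0 e e0; near=> n.
have n0 : (0 < n)%N by near: n; exact: nbhs_infty_gt.
have nR0 : (0 : R) < n%:R by rewrite ltr0n.
have ne : n%:R^-1 <= e.
  rewrite invf_ple ?posrE //; near: n; exact: nbhs_infty_ger.
have /andP[h1 h2] := truncn_itv (mulr_ge0 (ltW nR0) s0).
rewrite ltr_pdivlMr // mulrC h2 /= -natr1 mulrDl mul1r lerD //.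
by rewrite ler_pdivrMr // [s * _]mulrC.
Unshelve. all: by end_near. Qed.

(** Sampling [f] at the right end of the grid cell of [s] gives measurable step functions, and these
    converge to [f s] by right continuity. *)
Lemma cadlag_measurable {R : realType} (f : R -> R) (T : R) :
  cadlag f -> measurable_fun `[0, T] f.
Proof.
move=> fcl.
refine (@measurable_fun_cvg _ _ _ `[0, T]%classic
  (fun n s => f ((Num.truncn (n%:R * s)).+1%:R / n%:R)) f _ _).
  by move=> n; exact: (measurable_comp_truncn _ n (fun k => f (k.+1%:R / n%:R))).
move=> s; rewrite /= in_itv /= => /andP[s0 _].
apply/cvgrPdistC_le => e e0.
have [eta [l [eta0 fs]]] := cadlag_local f s e fcl s0 e0.
have eta20 : 0 < eta / 2 by rewrite divr_gt0.
apply: filterS (cvg_truncnS s s0 (eta / 2) eta20) => n /andP[sn ns].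
set u := _ / _ in sn ns *.
have u0 : 0 <= u by exact: le_trans s0 (ltW sn).
have [|_] := fs u u0; last by apply; exact: ltW.
by rewrite ger0_norm ?subr_ge0 ?ltW //; lra.
Qed.

Lemma bounded_integrable_itv {R : realType} (a b M : R) (f : R -> R) :
  measurable_fun `[a, b] f -> (forall t, a <= t <= b -> `|f t| <= M) ->
  lebesgue_measure.-integrable `[a, b] (EFin \o f).
Proof.
move=> mf fM; apply: measurable_bounded_integrable => //.
  by rewrite /= lebesgue_measure_itv; case: ifP => // _; rewrite -EFinB ltry.
exists `|M|; split => // B MB t /=; rewrite in_itv /= => /fM ftM.
exact: le_trans ftM (le_trans (ler_norm M) (ltW MB)).
Qed.

(** On [[0, T]] the integrand takes only the values [h k] with [k] at most the integer part of
    [n * T], so it is bounded. *)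
Lemma integrable_comp_truncn {R : realType} (n : nat) (h : nat -> R) (T : R) :
  lebesgue_measure.-integrable `[0, T]
    (EFin \o (fun s => h (Num.truncn (n%:R * s)))).
Proof.
have [M hM] := seq_common_upper_bound _
  (iota 0 (Num.truncn (n%:R * T)).+1) (fun k => `|h k|).
apply: (bounded_integrable_itv _ _ M); first exact: measurable_comp_truncn.
move=> t /andP[t0 tT]; apply: hM; rewrite mem_iota /= add0n ltnS.
have nt0 : 0 <= n%:R * t by rewrite mulr_ge0.
have ntT : n%:R * t <= n%:R * T by rewrite ler_wpM2l.
rewrite truncn_ge_nat; last exact: le_trans ntT.
by apply: le_trans ntT; rewrite truncn_le.
Qed.

(** Variation of constants: [x k] is [a ^+ k] times the sum over [j < k] of [a ^- j.+1 * y j], and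
    each summand divided by [n] is the integral over the cell from [j / n] to [(j + 1) / n].
    Half-open cells are disjoint and [Num.truncn (n%:R * s)] is constant on each. *)
Lemma linear_recursion_integral {R : realType} (n : nat) (a : R) (x y : nat -> R) :
  (0 < n)%N -> 0 < a -> x 0%N = 0 -> (forall k, x k.+1 = a * x k + y k) ->
  forall k, x k / n%:R = a ^+ k *
    \int[lebesgue_measure]_(s in `[0, k%:R / n%:R[)
      (a ^- (Num.truncn (n%:R * s)).+1 * y (Num.truncn (n%:R * s))).
Proof.
move=> n0 a0 x0 xS; have nR0 : (0 : R) < n%:R by rewrite ltr0n.
pose h j := a ^- j.+1 * y j.
elim=> [|k IH].
  by rewrite x0 !mul0r set_itvco0 Rintegral_set0 mulr0.
pose u : R := k%:R / n%:R; pose v : R := k.+1%:R / n%:R.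
rewrite -/u in IH; rewrite -/v.
have u0 : 0 <= u by rewrite divr_ge0.
have uv : u < v by rewrite ltr_pM2r ?invr_gt0 // ltr_nat.
have itvE : `[0, v[%classic = `[0, u[%classic `|` `[u, v[%classic :> set R.
  by rewrite -itv_bndbnd_setU // bnd_simp // ltW.
rewrite itvE Rintegral_setU //; last 2 first.
- rewrite -itvE; apply: integrableS (integrable_comp_truncn n h v) => //.
  by move=> s /=; rewrite !in_itv /= => /andP[-> /ltW].
- apply/disj_setPS => s /=; rewrite !in_itv /= => -[/andP[_ su] /andP[us _]].
  by move: su; rewrite ltNge us.
have vu : v - u = n%:R^-1 by rewrite /v /u -mulrBl -natrB // subSnn mul1r.
have stepE : \int[lebesgue_measure]_(s in `[u, v[) h (Num.truncn (n%:R * s)) =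
    h k / n%:R.
  transitivity (\int[lebesgue_measure]_(s in `[u, v[) (fun=> h k) s).
    apply: eq_Rintegral => s; rewrite inE /= in_itv /= => /andP[us sv].
    rewrite (_ : Num.truncn (n%:R * s) = k) //.
    by apply: truncn_def; rewrite mulrC -ler_pdivrMr // us /= -ltr_pdivlMr.
  by rewrite Rintegral_cst //= lebesgue_measure_itv /= lte_fin uv -EFinB /= vu.
rewrite mulrDr [X in _ = _ + _ * X]stepE exprS -mulrA -IH xS.
by rewrite /h exprS; field; rewrite gt_eqF // expf_neq0 ?gt_eqF.
Qed.

Lemma Rintegral_itvcc_split {R : realType} (f : R -> R) (u T : R) :
  0 <= u <= T -> lebesgue_measure.-integrable `[0, T] (EFin \o f) ->
  \int[lebesgue_measure]_(s in `[0, T]) f s =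
  \int[lebesgue_measure]_(s in `[0, u[) f s +
  \int[lebesgue_measure]_(s in `[u, T]) f s.
Proof.
move=> /andP[u0 uT] intf.
have itvE : `[0, T]%classic = `[0, u[%classic `|` `[u, T]%classic :> set R.
  by rewrite -itv_bndbnd_setU // bnd_simp.
rewrite itvE Rintegral_setU // -?itvE //.
apply/disj_setPS => s /=; rewrite !in_itv /= => -[/andP[_ su] /andP[us _]].
by move: su; rewrite ltNge us.
Qed.

Lemma normr_Rintegral_itv_le {R : realType} (f : R -> R) (a b M : R) :
  a <= b -> lebesgue_measure.-integrable `[a, b] (EFin \o f) ->
  (forall s, a <= s <= b -> `|f s| <= M) ->
  `|\int[lebesgue_measure]_(s in `[a, b]) f s| <= M * (b - a).
Proof.
move=> ab intf fM; apply: le_trans (le_normr_Rintegral _ intf) _ => //.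
have leb : fine (lebesgue_measure `[a, b]) = b - a.
  rewrite lebesgue_measure_itv /= lte_fin; case: ltgtP ab => // -> _.
  by rewrite subrr.
rewrite -leb -Rintegral_cst //; apply: le_Rintegral => //.
- exact: integrable_norm.
- apply: (bounded_integrable_itv _ _ `|M|); first exact: measurable_cst.
  by [].
Qed.

(* Squeezed by [u / (1 + u) <= ln (1 + u) <= u] at [u = gam_ n / n]. *)
Lemma cvg_ln_growth {R : realType} (gam : R) (gam_ : nat -> R) :
  gam_ n @[n --> \oo] --> gam ->
  n%:R * ln (1 + gam_ n / n%:R) @[n --> \oo] --> gam /\
  \forall n \near \oo, 0 < 1 + gam_ n / n%:R.
Proof.
move=> gcvg; pose G := `|gam| + 1.
have G0 : 0 < G by rewrite ltr_wpDl.
have near_small e : 0 < e -> \forall n \near \oo,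
    [/\ (0 : R) < n%:R, (n%:R : R)^-1 <= e & `|gam_ n| <= G].
  move=> e0; near=> n.
  have n0 : (0 < n)%N by near: n; exact: nbhs_infty_gt.
  split; first by rewrite ltr0n.
    rewrite invf_ple ?posrE ?ltr0n //; near: n; exact: nbhs_infty_ger.
  have : `|gam_ n - gam| <= 1.
    by near: n; move/cvgrPdistC_le: gcvg; apply.
  by move=> h; rewrite -(subrK gam (gam_ n)); apply: le_trans (ler_normD _ _) _;
    rewrite /G addrC lerD2l.
have usmall n e : 0 < e -> (0 : R) < n%:R -> (n%:R : R)^-1 <= e / G -> `|gam_ n| <= G ->
    `|gam_ n / n%:R| <= e.
  move=> e0 n0 ne gG; rewrite normrM (gtr0_norm (x := n%:R^-1)) ?invr_gt0 //.
  rewrite -(divfK (lt0r_neq0 G0) e) mulrC; apply: ler_pM => //.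
have half0 : 0 < 2^-1 :> R by [].
split; last first.
  apply: filterS (near_small (2^-1 / G) (divr_gt0 half0 G0)) => n [n0 ne gG].
  have := usmall n 2^-1 half0 n0 ne gG; rewrite ler_norml; lra.
apply/cvgrPdistC_le => e e0.
have e40 : 0 < e / (4 * G) by rewrite divr_gt0 // mulr_gt0.
(* The bound [1 / 2] on [u] gives [(1 + u)^-1 <= 2]; the other one makes [G * e1 * 2] at most
   [e / 2]. *)
pose e1 := Num.min 2^-1 (e / (4 * G)).
have e10 : 0 < e1 by rewrite lt_min half0.
near=> n.
have [n0 ne gG] : [/\ (0 : R) < n%:R, (n%:R : R)^-1 <= e1 / G & `|gam_ n| <= G].
  by near: n; apply: near_small; rewrite divr_gt0.
have gn : `|gam_ n - gam| <= e / 2.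
  by near: n; move/cvgrPdistC_le: gcvg; apply; rewrite divr_gt0.
have := usmall n e1 e10 n0 ne gG; set u := gam_ n / n%:R.
rewrite le_min => /andP[u2 ue].
have u1 : 0 < 1 + u by move: u2; rewrite ler_norml; lra.
have gE : gam_ n = n%:R * u by rewrite /u mulrC divfK // gt_eqF.
have ub : n%:R * ln (1 + u) <= gam_ n.
  by rewrite gE ler_pM2l //; apply: le_ln1Dx; lra.
have lb : gam_ n - gam_ n * u / (1 + u) <= n%:R * ln (1 + u).
  have -> : gam_ n - gam_ n * u / (1 + u) = n%:R * (u / (1 + u)).
    by rewrite gE; field; rewrite gt_eqF.
  rewrite ler_pM2l //.
  (* The lower bound is the upper bound [ln (1 + v) <= v] applied to the inverse
     [(1 + u)^-1 = 1 - u / (1 + u)]. *)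
  have -> : ln (1 + u) = - ln (1 + - (u / (1 + u))).
    rewrite (_ : 1 + - (u / (1 + u)) = (1 + u)^-1); last by field; rewrite gt_eqF.
    by rewrite lnV ?posrE // opprK.
  rewrite lerNr; apply: le_ln1Dx.
  suff : 0 < 1 - u / (1 + u) by lra.
  by rewrite (_ : 1 - _ = (1 + u)^-1) ?invr_gt0 //; field; rewrite gt_eqF.
have small : gam_ n * u / (1 + u) <= e / 2.
  apply: le_trans (ler_norm _) _.
  rewrite normrM [`|gam_ n * u|]normrM.
  have i2 : `|(1 + u)^-1| <= 2.
    rewrite gtr0_norm ?invr_gt0 // invf_ple ?posrE //.
    by move: u2; rewrite ler_norml; lra.
  have -> : e / 2 = G * (e / (4 * G)) * 2 by field; rewrite gt_eqF.
  by apply: ler_pM => //; exact: ler_pM.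
by move: gn; rewrite !ler_norml; lra.
Unshelve. all: by end_near. Qed.

(** For each [k] the jumps larger than [1 / (k + 1)] lie in a finite set; the union of these sets is
    countable, hence null. *)
Lemma ae_continuity_point_of_cadlag {R : realType} (f : R -> R) (T : R) :
  cadlag f -> {ae lebesgue_measure, forall u, 0 <= u <= T ->
    forall e, 0 < e -> exists2 dl, 0 < dl &
      forall v, 0 <= v -> `|v - u| < dl -> `|f v - f u| <= e}.
Proof.
move=> fcl.
have eps0 k : 0 < k.+1%:R^-1 :> R by rewrite invr_gt0.
have [s Hs] := choice (fun k => cadlag_finite_large_jumps f T k.+1%:R^-1 fcl (eps0 k)).
have cN : countable (\bigcup_k [set` s k]).
  by apply: bigcup_countable => // k _; apply: finite_set_countable; exact: finite_seq.
exists (\bigcup_k [set` s k]); split.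
- by apply: countable_measurable cN => t; exact: measurable_set1.
- exact: countable_lebesgue_measure0.
move=> u /= Hu; apply: contrapT => Nu; apply: Hu => uT e e0.
have [k ke] : exists k, k.+1%:R^-1 <= e.
  have := near_infty_natSinv_lt (PosNum e0) => /filter_ex[k ke].
  by exists k; exact: ltW.
have us : u \notin s k by apply/negP => us; apply: Nu; exists k.
have [dl dl0 fdl] := Hs k u uT us.
by exists dl => // v v0 vu; apply: le_trans ke; exact: fdl.
Qed.

(** * Convergence in L1 of the discounted immigration means *)

Section weighted_L1_convergence.
Context {R : realType} (beta : R -> R) (y : nat -> nat -> R).
Context (gam : R) (g_ : nat -> R).
Context (beta_cadlag : cadlag beta).
Context (g_cvg : g_ n @[n --> \oo] --> gam).
Context (y_near : forall T e : R, 0 <= T -> 0 < e ->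
  \forall n \near \oo, forall s : R, 0 <= s <= T ->
  exists u : R, [/\ 0 <= u <= T + 1, `|u - s| <= e &
                `|y n (Num.truncn (n%:R * s)) - beta u| <= e]).

(** When [g_ n] is [n] times the logarithm of the offspring mean, the exponential is the power
    [a ^- (Num.truncn (n%:R * s)).+1] of [linear_recursion_integral]. *)
Definition weighted_step (n : nat) (s : R) :=
  expR (- (g_ n * ((Num.truncn (n%:R * s)).+1%:R / n%:R))) *
  y n (Num.truncn (n%:R * s)).
Definition weighted_limit (s : R) := expR (- (gam * s)) * beta s.

Lemma weighted_limit_bounded (T : R) :
  exists2 M, 0 <= M & forall s, 0 <= s <= T -> `|weighted_limit s| <= M.
Proof.
have [M M0 bM] := cadlag_bounded beta T beta_cadlag.
exists (expR (`|gam| * `|T|) * M) => [|s sT]; first by rewrite mulr_ge0 ?expR_ge0.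
rewrite /weighted_limit normrM ger0_norm ?expR_ge0 //.
apply: ler_pM; rewrite ?expR_ge0 // ?bM //.
have /andP[s0 sT'] := sT.
rewrite ler_expR; apply: le_trans (ler_norm _) _; rewrite normrN normrM.
by rewrite ler_wpM2l // ger0_norm // (le_trans sT') // ler_norm.
Qed.

Lemma weighted_limit_measurable (T : R) : measurable_fun `[0, T] weighted_limit.
Proof.
apply: measurable_funM; last exact: cadlag_measurable.
apply: (measurableT_comp (@measurable_expR R)).
apply: (measurableT_comp (@oppr_measurable R setT)).
exact: mulrl_measurable.
Qed.

Lemma weighted_limit_integrable (T : R) :
  lebesgue_measure.-integrable `[0, T] (EFin \o weighted_limit).
Proof.
have [M _ HM] := weighted_limit_bounded T.
exact: bounded_integrable_itv (weighted_limit_measurable T) HM.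
Qed.

Lemma weighted_step_integrable (n : nat) (T : R) :
  lebesgue_measure.-integrable `[0, T] (EFin \o weighted_step n).
Proof.
exact: (integrable_comp_truncn n
  (fun k => expR (- (g_ n * (k.+1%:R / n%:R))) * y n k)).
Qed.

(** This is the dominating constant. For large [n], [y n] is within [1] of a value of [beta] on
    [[0, T + 1]], and the exponent is at most [(|gam| + 1) * (T + 1)] since the right end of a cell
    meeting [[0, T]] is at most [T + 1]. *)
Lemma weighted_step_near_bounded (T : R) : 0 <= T ->
  exists M, \forall n \near \oo, forall s, 0 <= s <= T -> `|weighted_step n s| <= M.
Proof.
move=> T0; have [M M0 bM] := cadlag_bounded beta (T + 1) beta_cadlag.
exists (expR ((`|gam| + 1) * (T + 1)) * (M + 1)); near=> n => s sT.
have n0 : (0 < n)%N by near: n; exact: nbhs_infty_gt.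
have nR0 : (0 : R) < n%:R by rewrite ltr0n.
have gn : `|g_ n| <= `|gam| + 1.
  have : `|g_ n - gam| <= 1 by near: n; move/cvgrPdistC_le: g_cvg; apply.
  by move=> h; rewrite -(subrK gam (g_ n)); apply: le_trans (ler_normD _ _) _;
    rewrite addrC lerD2l.
have yn : `|y n (Num.truncn (n%:R * s))| <= M + 1.
  have Hn : forall s, 0 <= s <= T -> exists u, [/\ 0 <= u <= T + 1, `|u - s| <= 1 &
                `|y n (Num.truncn (n%:R * s)) - beta u| <= 1].
    by near: n; exact: y_near.
  have [u [uT _ yu]] := Hn s sT; have bu := bM u uT.
  by rewrite -(subrK (beta u) (y n _)); apply: le_trans (ler_normD _ _) _; lra.
have /andP[s0 sT'] := sT.
have /andP[h1 h2] := truncn_itv (mulr_ge0 (ltW nR0) s0).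
rewrite /weighted_step normrM ger0_norm ?expR_ge0 //; apply: ler_pM; rewrite ?expR_ge0 //.
rewrite ler_expR; apply: le_trans (ler_norm _) _; rewrite normrN normrM.
apply: ler_pM => //; rewrite ger0_norm; last by rewrite divr_ge0.
rewrite ler_pdivrMr // mulrDl mul1r -natr1 lerD ?ler1n //.
by apply: le_trans h1 _; rewrite mulrC ler_wpM2r // ltW.
Unshelve. all: by end_near. Qed.

(** At a continuity point [s] of [beta], the nearby point [u] given by [y_near] tends to [s], so
    [beta u] tends to [beta s]. *)
Lemma weighted_step_ae_cvg (T : R) :
  {ae lebesgue_measure, forall s, 0 <= s <= T ->
    weighted_step n s @[n --> \oo] --> weighted_limit s}.
Proof.
have [N [mN N0 subN]] := ae_continuity_point_of_cadlag beta T beta_cadlag.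
exists N; split => // s /= Hs; apply: subN => /= cont_s; apply: Hs => sT.
have {}cont_s := cont_s sT; have /andP[s0 sT'] := sT.
have T0 : 0 <= T by exact: le_trans sT'.
apply: cvgM.
  apply: continuous_cvg; first exact: continuous_expR.
  apply: cvgN; apply: cvgM => //.
  apply/cvgrPdistC_le => e e0.
  apply: filterS (cvg_truncnS s s0 e e0) => n /andP[h1 h2].
  by rewrite ger0_norm ?subr_ge0 ?(ltW h1) // lerBlDl.
apply/cvgrPdistC_le => e e0; have e20 : 0 < e / 2 by rewrite divr_gt0.
have [dl dl0 bdl] := cont_s (e / 2) e20.
have m0 : 0 < Num.min (dl / 2) (e / 2) by rewrite lt_min divr_gt0.
apply: filterS (y_near T _ T0 m0) => n /(_ s sT)[u [/andP[u0 _]]].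
rewrite !le_min => /andP[us _] /andP[_ yu].
have bu : `|beta u - beta s| <= e / 2.
  by apply: bdl => //; apply: le_lt_trans us _; lra.
by rewrite -(subrK (beta u) (y n _)) -addrA; apply: le_trans (ler_normD _ _) _; lra.
Qed.

Lemma weighted_step_L1_cvg (T e : R) : 0 <= T -> 0 < e ->
  \forall n \near \oo,
  \int[lebesgue_measure]_(s in `[0, T]) `|weighted_step n s - weighted_limit s| <= e.
Proof.
move=> T0 e0; have [M [N _ HM]] := weighted_step_near_bounded T T0.
have mT : measurable (`[0, T]%classic : set R) by [].
have iM : lebesgue_measure.-integrable (`[0, T]%classic : set R) (cst M%:E).
  by apply: (bounded_integrable_itv _ _ `|M|); first exact: measurable_cst.
(* The domination holds only from rank [N] on, so the theorem is applied to the sequence shifted by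
   [N]. *)
have [||||_ L1 _] := @dominated_convergence _ _ R lebesgue_measure `[0, T]%classic mT
  (fun n => EFin \o weighted_step (n + N)%N) (EFin \o weighted_limit) (cst M%:E)
  _ _ _ iM.
- by move=> n; exact: measurable_int (weighted_step_integrable _ _).
- exact: measurable_int (weighted_limit_integrable _).
- have [Z [mZ Z0 subZ]] := weighted_step_ae_cvg T.
  exists Z; split => // s /= Hs; apply: subZ => /= cvg_s; apply: Hs.
  rewrite in_itv /= => sT.
  apply: cvg_EFin; first by apply: nearW.
  have := cvg_s sT; rewrite -(cvg_shiftn N); exact.
- exists set0; split => // s /= Hs; apply: Hs => n.
  by rewrite in_itv /= lee_fin; apply: HM => /=; rewrite leq_addl.
move/fine_cvgP : L1 => [_ /cvgrPdistC_le/(_ _ e0)][K _ HK].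
exists (K + N)%N => // n /= KN.
have nN : (N <= n)%N by exact: leq_trans (leq_addl _ _) KN.
have := HK (n - N)%N; rewrite /= leq_subRL // addnC => /(_ KN).
rewrite subnK // subr0; apply: le_trans.
exact: ler_norm.
Qed.

End weighted_L1_convergence.

(** For [q <= p], factor out [expR p] and use [1 - expR (q - p) <= p - q]. *)
Lemma expR_dist_le {R : realType} (c p q : R) :
  p <= c -> q <= c -> `|expR p - expR q| <= expR c * `|p - q|.
Proof.
wlog qp : p q / q <= p.
  move=> H pc qc; have [/H|/ltW/H] := leP q p; first exact.
  by rewrite [`|expR q - _|]distrC [`|q - p|]distrC; exact.
move=> pc _; rewrite !ger0_norm ?subr_ge0 ?ler_expR //.
have -> : expR p - expR q = expR p * (1 - expR (q - p)).
  by rewrite mulrBr mulr1 -expRD [p + _]addrC subrK.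
apply: ler_pM; rewrite ?expR_ge0 ?ler_expR //.
  by rewrite subr_ge0 expR_le1 subr_le0.
by have := expR_ge1Dx (q - p); lra.
Qed.

(** With [u] the grid point below [t], the difference is that of [expR (g_ n * u) * I] and
    [expR (gam * t) * Z], where [I] and [Z] integrate the weighted functions up to [u] and [t]. Both
    factors are compared with bounds that depend on [T] but not on [t]. *)
Lemma near_critical_recursion_limit {R : realType} (gam : R) (gam_ : nat -> R)
    (x y : nat -> nat -> R) (beta : R -> R) :
  gam_ n @[n --> \oo] --> gam ->
  (forall n, (0 < n)%N -> x n 0%N = 0) ->
  (forall n k, (0 < n)%N -> x n k.+1 = (1 + gam_ n / n%:R) * x n k + y n k) ->
  cadlag beta ->
  (forall T e : R, 0 <= T -> 0 < e ->
   \forall n \near \oo, forall s : R, 0 <= s <= T ->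
   exists u : R, [/\ 0 <= u <= T + 1, `|u - s| <= e &
                     `|y n (Num.truncn (n%:R * s)) - beta u| <= e]) ->
  forall T e : R, 0 <= T -> 0 < e ->
  \forall n \near \oo, forall t : R, 0 <= t <= T ->
    `|x n (Num.truncn (n%:R * t)) / n%:R -
      \int[lebesgue_measure]_(s in `[0, t]) (expR (gam * (t - s)) * beta s)| <= e.
Proof.
move=> gcvg x0 xS bcl y_near T e T0 e0.
have [g_cvg a_pos] := cvg_ln_growth gam gam_ gcvg.
set g_ := fun n : nat => n%:R * ln (1 + gam_ n / n%:R) in g_cvg.
have [M M0 HM] := weighted_limit_bounded beta gam bcl T.
pose C := expR ((`|gam| + 1) * T).
have C0 : 0 < C by exact: expR_gt0.
(* [K * dl] is the total error once [1 / n], the distance from [g_ n] to [gam] and the L1 distance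
   on [[0, T]] are all at most [dl]; [dl <= 1] makes [C] a bound for [expR (g_ n * u)]. *)
pose K := C * (1 + M) + M * T * (C * (T + `|gam|)).
have K0 : 0 < K.
  rewrite ltr_pwDl //; first by rewrite mulr_gt0 // ltr_pwDl.
  by rewrite !mulr_ge0 ?addr_ge0 // ltW.
pose dl := Num.min 1 (e / K).
have dl0 : 0 < dl by rewrite lt_min ltr01 divr_gt0.
have dl1 : dl <= 1 by rewrite ge_min lexx.
have dlK : K * dl <= e by rewrite mulrC -ler_pdivlMr // ge_min lexx orbT.
near=> n => t /andP[t0 tT].
have n0 : (0 < n)%N by near: n; exact: nbhs_infty_gt.
have nR0 : (0 : R) < n%:R by rewrite ltr0n.
have ndl : (n%:R : R)^-1 <= dl.
  rewrite invf_ple ?posrE //; near: n; exact: nbhs_infty_ger.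
have gdl : `|g_ n - gam| <= dl by near: n; move/cvgrPdistC_le: g_cvg; exact.
have apos : 0 < 1 + gam_ n / n%:R by near: n.
have L1 : \int[lebesgue_measure]_(s in `[0, T])
    `|weighted_step y g_ n s - weighted_limit beta gam s| <= dl.
  by near: n; exact: weighted_step_L1_cvg.
have nt0 : 0 <= n%:R * t by rewrite mulr_ge0.
have /andP[kt tk] := truncn_itv nt0.
set k := Num.truncn (n%:R * t) in kt tk *; pose u : R := k%:R / n%:R.
have u0 : 0 <= u by rewrite divr_ge0.
have ut : u <= t by rewrite ler_pdivrMr // mulrC.
have tu : t - u <= n%:R^-1.
  by rewrite lerBlDl -[X in _ + X]mul1r -mulrDl natr1 ler_pdivlMr // mulrC ltW.
have uT : u <= T by exact: le_trans tT.
set a := 1 + gam_ n / n%:R in apos.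
have aE j : a ^+ j = expR (g_ n * (j%:R / n%:R)).
  rewrite -[a in LHS](lnK (x := a)) ?posrE // -expRM_natr; congr expR.
  by rewrite /g_ -/a; field; rewrite gt_eqF.
pose I := \int[lebesgue_measure]_(s in `[0, u[) weighted_step y g_ n s.
pose Z := \int[lebesgue_measure]_(s in `[0, t]) weighted_limit beta gam s.
have xE : x n k / n%:R = expR (g_ n * u) * I.
  rewrite (linear_recursion_integral n a (x n) (y n)) //; last 2 first.
  - exact: x0.
  - by move=> j; exact: xS.
  rewrite aE; congr (_ * _); apply: eq_Rintegral => s _.
  by rewrite aE -expRN.
have BE : \int[lebesgue_measure]_(s in `[0, t]) (expR (gam * (t - s)) * beta s) =
    expR (gam * t) * Z.
  rewrite -RintegralZl //; last exact: weighted_limit_integrable.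
  apply: eq_Rintegral => s _.
  by rewrite /weighted_limit mulrA -expRD mulrBr.
rewrite xE BE.
have int_lim v := weighted_limit_integrable beta gam bcl v.
have int_step v := weighted_step_integrable y g_ n v.
have Zle : `|Z| <= M * T.
  apply: le_trans (normr_Rintegral_itv_le _ _ _ M t0 (int_lim t) _) _.
    by move=> s /andP[s0 st]; apply: HM; rewrite s0 (le_trans st).
  by rewrite subr0 ler_wpM2l.
have int_ut f : lebesgue_measure.-integrable (`[0, T]%classic : set R) (EFin \o f) ->
    lebesgue_measure.-integrable (`[0, u[%classic : set R) (EFin \o f).
  apply: integrableS => // s /=; rewrite !in_itv /= => /andP[-> su] /=.
  by rewrite (le_trans (ltW su)).
(* On [[0, u[] the L1 distance over all of [[0, T]] is used; the remaining piece [[u, t]] has length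
   at most [1 / n]. *)
have IZ : `|I - Z| <= dl + M * dl.
  rewrite /Z (Rintegral_itvcc_split _ u) ?u0 //.
  rewrite opprD addrA /I -RintegralB //; [|exact: int_ut|exact: int_ut].
  apply: le_trans (ler_normB _ _) _; apply: lerD.
    pose D s := weighted_step y g_ n s - weighted_limit beta gam s.
    have intD : lebesgue_measure.-integrable (`[0, T]%classic : set R) (EFin \o D).
      exact: (integrableB _ (int_step T) (int_lim T)).
    apply: le_trans (le_normr_Rintegral _ (int_ut D intD)) _ => //.
    apply: le_trans L1.
    rewrite [leRHS](Rintegral_itvcc_split _ u) ?u0 //; last exact: integrable_norm.
    by rewrite lerDl Rintegral_ge0.
  apply: le_trans (normr_Rintegral_itv_le _ _ _ M ut _ _) _.
  - apply: integrableS (int_lim t) => // s /=; rewrite !in_itv /= => /andP[us ->].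
    by rewrite (le_trans u0).
  - by move=> s /andP[us st]; apply: HM; rewrite (le_trans u0) // (le_trans st).
  by rewrite ler_wpM2l // (le_trans tu).
have expo p v : `|p| <= `|gam| + 1 -> 0 <= v <= T -> p * v <= (`|gam| + 1) * T.
  move=> pg /andP[v0 vT]; apply: le_trans (ler_norm _) _; rewrite normrM.
  by apply: ler_pM => //; rewrite ger0_norm.
have gn : `|g_ n| <= `|gam| + 1.
  rewrite -(subrK gam (g_ n)); apply: le_trans (ler_normD _ _) _.
  by rewrite addrC lerD2l (le_trans gdl).
have Ele : expR (g_ n * u) <= C by rewrite ler_expR expo // u0.
have EE : `|expR (g_ n * u) - expR (gam * t)| <= C * ((T + `|gam|) * dl).
  apply: le_trans (expR_dist_le _ _ _ (expo _ _ gn _) (expo _ _ _ _)) _.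
  - by rewrite u0.
  - by rewrite lerDl.
  - by rewrite t0.
  rewrite ler_pM2l // (_ : _ - _ = (g_ n - gam) * u + gam * (u - t)); last by ring.
  apply: le_trans (ler_normD _ _) _.
  rewrite [`|_ * u|]normrM [`|gam * _|]normrM mulrDl [T * dl]mulrC.
  apply: lerD; last first.
    by apply: ler_pM => //; rewrite distrC ger0_norm ?subr_ge0 // (le_trans tu).
  by apply: ler_pM => //; rewrite ger0_norm.
have -> : expR (g_ n * u) * I - expR (gam * t) * Z =
  expR (g_ n * u) * (I - Z) + Z * (expR (g_ n * u) - expR (gam * t)) by ring.
apply: le_trans dlK; rewrite /K mulrDl; apply: le_trans (ler_normD _ _) _.
rewrite !normrM (ger0_norm (expR_ge0 _)); apply: lerD.
  by rewrite -mulrA; apply: ler_pM => //; rewrite mulrDl mul1r.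
rewrite (_ : M * T * _ * dl = M * T * (C * ((T + `|gam|) * dl))); last by ring.
by apply: ler_pM.
Unshelve. all: by end_near. Qed.

(** * From expectations to the two real recursions *)

Theorem theorem3p5 (R : realType) (d : nat -> measure_display)
  (T : forall n : nat, measurableType (d n))
  (P : forall n : nat, probability (T n) R)
  (m : nat -> R)
  (xi : forall n : nat, nat -> nat -> {RV (P n) >-> nat})
  (Y : forall n : nat, nat -> {RV (P n) >-> nat})
  (X : forall n : nat, nat -> T n -> nat)
  (beta : R -> R)
  (m_gt0 : forall n : nat, (0 < n)%N -> 0 < m n)
  (GW : forall n : nat, (0 < n)%N -> GW_immigration (xi n) (Y n) (X n))
  (xi_fin : forall n : nat, (0 < n)%N ->
     ('E_(P n)[fun w => (xi n 1%N 1%N w)%:R] < +oo)%E)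
  (Y_fin : forall n k : nat, (0 < n)%N ->
     ('E_(P n)[fun w => (Y n k w)%:R] < +oo)%E)
  (beta_cadlag : cadlag beta)
  (Y_cvg : cvg_J1
     (fun (n : nat) (t : R) =>
        'E_(P n)[fun w => ((m n)^-1 * (Y n (Num.truncn (n%:R * t)) w)%:R)%R]%E)
     beta) :
  (forall a : R, 0 <= a < 1 ->
     'E_(P n)[fun w => (xi n 1%N 1%N w)%:R]%E @[n --> \oo] --> a%:E ->
     {within `[0, +oo[, continuous beta} -> beta 0 = 0 ->
     cvg_locally_uniformly
       (fun (n : nat) (t : R) =>
          (((m n)^-1)%:E
           * 'E_(P n)[fun w => (X n (Num.truncn (n%:R * t)) w)%:R])%E)
       (fun t : R => (1 - a)^-1 * beta t))
  /\
  (forall (gamma : R) (gamma_ : nat -> R),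
     gamma_ n @[n --> \oo] --> gamma ->
     (forall n : nat, (0 < n)%N ->
        'E_(P n)[fun w => (xi n 1%N 1%N w)%:R]%E = (1 + gamma_ n / n%:R)%:E) ->
     cvg_locally_uniformly
       (fun (n : nat) (t : R) =>
          (((n%:R * m n)^-1)%:E
           * 'E_(P n)[fun w => (X n (Num.truncn (n%:R * t)) w)%:R])%E)
       (fun t : R => \int[lebesgue_measure]_(s in `[0, t])
                       (expR (gamma * (t - s)) * beta s))).
Proof.
(* All means are finite for [0 < n], so the real numbers [a_], [x] and [y] carry the recursion; at
   [n = 0] they are unconstrained defaults. *)
pose a_ n := fine 'E_(P n)[fun w => (xi n 1%N 1%N w)%:R]%E.
pose x n k := (m n)^-1 * fine 'E_(P n)[fun w => (X n k w)%:R]%E.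
pose y n k := (m n)^-1 * fine 'E_(P n)[fun w => (Y n k w)%:R]%E.
have aE n : (0 < n)%N -> 'E_(P n)[fun w => (xi n 1%N 1%N w)%:R]%E = (a_ n)%:E.
  by move=> n0; rewrite fineK // ge0_fin_numE ?expectation_nat_ge0 ?xi_fin.
have yfin n k : (0 < n)%N -> ('E_(P n)[fun w => (Y n k w)%:R] \is a fin_num)%E.
  by move=> n0; rewrite ge0_fin_numE ?expectation_nat_ge0 ?Y_fin.
have xfin n k : (0 < n)%N -> ('E_(P n)[fun w => (X n k w)%:R] \is a fin_num)%E.
  move=> n0; apply: GW_expectation_fin_num (GW n n0) (xi_fin n n0) _ k => j.
  exact: Y_fin.
have yE n k : (0 < n)%N ->
    'E_(P n)[fun w => ((m n)^-1 * (Y n k w)%:R)%R]%E = (y n k)%:E.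
  move=> n0; rewrite expectation_natZ ?invr_ge0 ?ltW ?m_gt0 //.
  by rewrite /y EFinM fineK ?yfin.
have xE n k : (0 < n)%N -> (((m n)^-1)%:E * 'E_(P n)[fun w => (X n k w)%:R])%E =
    (x n k)%:E.
  by move=> n0; rewrite /x EFinM fineK ?xfin.
have x0 n : (0 < n)%N -> x n 0%N = 0.
  by move=> n0; rewrite /x (GW_expectation0 _ _ _ _ (GW n n0)) mulr0.
have xS n k : (0 < n)%N -> x n k.+1 = a_ n * x n k + y n k.
  move=> n0; rewrite /x (GW_expectationS _ _ _ _ (GW n n0)) ?xi_fin // aE //.
  rewrite -(fineK (xfin n k n0)) -(fineK (yfin n k n0)) -EFinM -EFinD /= /y.
  by ring.
split.
- move=> a a01 a_cvg bcont b0 S S0; apply: near_cvg_sup_dist.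
    by exists 0; rewrite /= in_itv /= lexx.
  move=> e e0.
  have a_a : a_ n @[n --> \oo] --> a by exact: fine_cvg a_cvg.
  have a_ge0 n : 0 <= a_ n by rewrite fine_ge0 ?expectation_nat_ge0.
  (* Continuity of [beta] upgrades the J1 convergence to a locally uniform one. *)
  have y_near (S' e' : R) : 0 <= S' -> 0 < e' ->
      \forall n \near \oo, forall s : R, 0 <= s <= S' ->
      `|y n (Num.truncn (n%:R * s)) - beta s| <= e'.
    move=> S'0 e'0; near=> n => s sS.
    have n0 : (0 < n)%N by near: n; exact: nbhs_infty_gt.
    rewrite -lee_fin -abse_EFin EFinB -yE //.
    suff H : forall t, `[0, S']%classic t -> (`|'E_(P n)[fun w =>
        ((m n)^-1 * (Y n (Num.truncn (n%:R * t)) w)%:R)%R] - (beta t)%:E| <= e'%:E)%E.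
      by apply: H; rewrite /= in_itv.
    near: n.
    exact: (cvg_sup_dist_near _ _ _ (cvg_J1_continuous _ _ Y_cvg bcont S' S'0)).
  have := subcritical_recursion_limit a a_ x y beta a01 a_ge0 a_a x0 xS beta_cadlag
    bcont b0 y_near S e S0 e0.
  apply: filterS2 (nbhs_infty_gt 0) => n n0 Hn t /=; rewrite in_itv /= => tS.
  by rewrite xE // -EFinB abse_EFin lee_fin; exact: Hn.
- move=> gam gam_ g_cvg a_E S S0; apply: near_cvg_sup_dist.
    by exists 0; rewrite /= in_itv /= lexx.
  move=> e e0.
  (* Here [beta] may jump, so the J1 convergence enters only through nearby points [u]. *)
  have y_near (S' e' : R) : 0 <= S' -> 0 < e' ->
      \forall n \near \oo, forall s : R, 0 <= s <= S' ->
      exists u : R, [/\ 0 <= u <= S' + 1, `|u - s| <= e' &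
        `|y n (Num.truncn (n%:R * s)) - beta u| <= e'].
    move=> S'0 e'0.
    apply: filterS2 (nbhs_infty_gt 0) (cvg_J1_nearby _ _ Y_cvg S' e' S'0 e'0).
    move=> n n0 Hn s /Hn[u [uS us yu]]; exists u; split => //.
    by move: yu; rewrite yE // -EFinB abse_EFin lee_fin.
  have xS' n k : (0 < n)%N -> x n k.+1 = (1 + gam_ n / n%:R) * x n k + y n k.
    by move=> n0; rewrite xS // /a_ a_E.
  have := near_critical_recursion_limit gam gam_ x y beta g_cvg x0 xS' beta_cadlag
    y_near S e S0 e0.
  apply: filterS2 (nbhs_infty_gt 0) => n n0 Hn t /=; rewrite in_itv /= => tS.
  rewrite invfM EFinM -muleA xE // -EFinM -EFinB abse_EFin lee_fin mulrC.
  exact: Hn.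
Unshelve. all: by end_near. Qed.
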